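(* Let $K=\mathbb{F}_3$ and let $S$ be a smooth cubic surface over $K$. Suppose $S$ contains a skew pair of lines $\ell,\ell'$ defined over $K$, and that each of $\ell$ and $\ell'$ contains at most one $K$-rational Eckardt point. Then there exists a point $P\in\ell(K)\cup\ell'(K)$ such that $\mathrm{Span}(P)=S(K)$.
   Context: A smooth cubic surface $S$ over $K$ is a nonsingular surface in $\mathbb{P}^3$ defined by a homogeneous cubic polynomial over $K$. A $K$-line is a line in $\mathbb{P}^3$ defined over $K$. A line ''on $S$'' means a line over $\overline{K}$ contained in $S$. A skew pair of lines is a pair of disjoint lines. An Eckardt point is a point of $S$ through which three of the lines on $S$ pass. For a line $\ell\not\subset S$, $\ell\cdot S=P+Q+R$ with multiplicity. For $B\subseteq S(K)$ define $B_0=B$ and $B_{n+1}$ as the set of $R\in S(K)$ such that either $R\in B_n$ or there exist $P,Q\in B_n$ and a $K$-line $\ell\not\subset S$ with $\ell\cdot S=P+Q+R$; $\mathrm{Span}(B)=\bigcup_n B_n$, and $\mathrm{Span}(P)=\mathrm{Span}(\{P\})$. *)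

(* Defs.v *)
From HB Require Import structures.
From mathcomp Require Import all_boot all_order all_algebra all_field.
Set Implicit Arguments. Unset Strict Implicit. Unset Printing Implicit Defensive.
Import GRing.Theory.
Local Open Scope ring_scope.

(* A homogeneous cubic form over F_3 in x_0..x_3:
   F(x) = sum_{i,j,k} c i j k * x_i x_j x_k. *)
Definition cubic := 'I_4 -> 'I_4 -> 'I_4 -> 'F_3.

Definition evalC (R : comNzRingType) (f : 'F_3 -> R) (c : cubic) (x : 'I_4 -> R) : R :=
  \sum_(i < 4) \sum_(j < 4) \sum_(k < 4) f (c i j k) * (x i * x j * x k).

Definition dC (R : comNzRingType) (f : 'F_3 -> R) (c : cubic) (m : 'I_4) (x : 'I_4 -> R) : R :=
  \sum_(i < 4) \sum_(j < 4) \sum_(k < 4) f (c i j k) *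
     ((i == m)%:R * (x j * x k) + (j == m)%:R * (x i * x k) + (k == m)%:R * (x i * x j)).

Definition emb (L : fieldExtType 'F_3) (a : 'F_3) : L := a%:A.

Definition idF3 (a : 'F_3) : 'F_3 := a.

(* Smoothness over the algebraic closure: every point of P^3(Kbar) lies in
   P^3(L) for some finite extension L of F_3; no such point is singular. *)
Definition smooth (c : cubic) : Prop :=
  forall (L : fieldExtType 'F_3) (x : 'rV[L]_4), x != 0 ->
    ~ (evalC (@emb L) c (fun i => x 0 i) = 0 /\
       forall m, dC (@emb L) c m (fun i => x 0 i) = 0).

(* Restriction of F to the line through u, v: the binary cubic
   g(s,t) = F(s u + t v), dehomogenized at t = 1 (s = 'X); this is
   injective on binary cubic forms. *)
Definition line_poly (L : fieldType) (f : 'F_3 -> L) (c : cubic) (u v : 'rV[L]_4) : {poly L} :=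
  evalC (fun a => (f a)%:P) c (fun i => 'X * (u 0 i)%:P + (v 0 i)%:P).

Definition independent (L : fieldType) (u v : 'rV[L]_4) : Prop :=
  forall a b : L, a *: u + b *: v = 0 -> a = 0 /\ b = 0.

Definition on_line (L : fieldType) (u v P : 'rV[L]_4) : Prop :=
  exists a b : L, P = a *: u + b *: v.

Definition line_in_S (L : fieldType) (f : 'F_3 -> L) (c : cubic) (u v : 'rV[L]_4) : Prop :=
  independent u v /\ line_poly f c u v = 0.

Definition distinct_lines (L : fieldType) (u v u' v' : 'rV[L]_4) : Prop :=
  ~ (on_line u v u' /\ on_line u v v').

Definition skew_lines (u v u' v' : 'rV['F_3]_4) : Prop :=
  forall a b a' b' : 'F_3, a *: u + b *: v = a' *: u' + b' *: v' -> a *: u + b *: v = 0.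

Definition on_SK (c : cubic) (P : 'rV['F_3]_4) : Prop :=
  P != 0 /\ evalC idF3 c (fun i => P 0 i) = 0.

(* K-rational Eckardt point: a point of S(K) through which three distinct
   lines on S (over Kbar, i.e. over some finite extension L) pass. *)
Definition eckardtK (c : cubic) (P : 'rV['F_3]_4) : Prop :=
  on_SK c P /\
  exists (L : fieldExtType 'F_3) (u1 v1 u2 v2 u3 v3 : 'rV[L]_4),
    [/\ line_in_S (@emb L) c u1 v1, line_in_S (@emb L) c u2 v2 & line_in_S (@emb L) c u3 v3] /\
    [/\ on_line u1 v1 (map_mx (@emb L) P), on_line u2 v2 (map_mx (@emb L) P) &
        on_line u3 v3 (map_mx (@emb L) P)] /\
    [/\ distinct_lines u1 v1 u2 v2, distinct_lines u1 v1 u3 v3 &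
        distinct_lines u2 v2 u3 v3].

(* There is a K-line l (spanned by u, v), not contained in S, with
   l . S = P + Q + R (with multiplicity). *)
Definition meet3 (c : cubic) (P Q R : 'rV['F_3]_4) : Prop :=
  exists u v : 'rV['F_3]_4,
    [/\ independent u v, line_poly idF3 c u v != 0 &
    exists p1 p2 q1 q2 r1 r2 lam : 'F_3,
      [/\ P = p1 *: u + p2 *: v, Q = q1 *: u + q2 *: v, R = r1 *: u + r2 *: v &
          line_poly idF3 c u v =
            lam%:P * ((p2%:P * 'X - p1%:P) * (q2%:P * 'X - q1%:P) * (r2%:P * 'X - r1%:P))]].

(* Span(P0) = union of the B_n, as the least set containing (the projective
   point) P0 and closed under the third-point operation. *)
Inductive in_span (c : cubic) (P0 : 'rV['F_3]_4) : 'rV['F_3]_4 -> Prop :=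
| span_base (a : 'F_3) : a != 0 -> in_span c P0 (a *: P0)
| span_step (P Q R : 'rV['F_3]_4) :
    in_span c P0 P -> in_span c P0 Q -> on_SK c R -> meet3 c P Q R -> in_span c P0 R.

(* Main.v *)
(* Let x = (a, b) and y = (d, e) be coordinates on the two skew lines.  A cubic
   vanishing on both is d q0(x) + e q1(x) + a r0(y) + b r1(y) with binary
   quadratic forms q0, q1, r0, r1.  Smoothness along the first line means that
   q0 and q1 have no common root over F_9, and then some choice of bases of the
   two lines turns (q0, q1) into (a^2, b^2) or (a^2 - b^2, a b).  This leaves
   finitely many (r0, r1): either r0 and r1 have a common root over F_9, or the
   surface has a singular rational point, or a point of one of the two lines
   generates S(F_3) by chords and tangents, or (only for (a^2, b^2)) both base
   points of the first line are Eckardt points with three rational lines. *)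
Require Import Defs.
From HB Require Import structures.
From mathcomp Require Import all_boot all_order all_algebra all_field.
From mathcomp Require Import ring.
Set Implicit Arguments. Unset Strict Implicit. Unset Printing Implicit Defensive.
Import GRing.Theory.
Local Open Scope ring_scope.

(** * Cubic forms vanishing on two skew lines *)

(* A copy of 'F_3 whose operations reduce by pattern matching alone, so that
   the kernel can evaluate the case analysis. *)
Inductive trit := T0 | T1 | T2.

Definition F3 (x : trit) : 'F_3 :=
  match x with T0 => 0 | T1 => 1 | T2 => - 1 end.

Definition tadd x y :=
  match x, y with
  | T0, z | z, T0 => z | T1, T1 => T2 | T2, T2 => T1 | _, _ => T0
  end.

Definition tmul x y :=
  match x, y with
  | T0, _ | _, T0 => T0 | T1, z | z, T1 => z | T2, T2 => T1
  end.

Definition topp x := match x with T0 => T0 | T1 => T2 | T2 => T1 end.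

Definition tzero x := if x is T0 then true else false.

Lemma F3D x y : F3 (tadd x y) = F3 x + F3 y.
Proof. by apply: val_inj; case: x; case: y. Qed.

Lemma F3M x y : F3 (tmul x y) = F3 x * F3 y.
Proof. by apply: val_inj; case: x; case: y. Qed.

Lemma F3N x : F3 (topp x) = - F3 x.
Proof. by apply: val_inj; case: x. Qed.

Lemma F3_surj (a : 'F_3) : exists x, a = F3 x.
Proof.
case: a => [[|[|[|//]]] lt_a]; [exists T0 | exists T1 | exists T2];
  exact: val_inj.
Qed.

Lemma F3_eq0 x : (F3 x == 0) = tzero x.
Proof. by case: x. Qed.

Definition tquad := (trit * trit * trit)%type.

Definition quadf (R : comNzRingType) (f : trit -> R) (q : tquad) (a b : R) : R :=
  let: (p, r, s) := q in f p * a ^+ 2 + f r * (a * b) + f s * b ^+ 2.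

Definition tform := ((tquad * tquad) * (tquad * tquad))%type.

Definition cubicf (R : comNzRingType) (f : trit -> R) (t : tform) (a b d e : R) : R :=
  d * quadf f t.1.1 a b + e * quadf f t.1.2 a b
  + a * quadf f t.2.1 d e + b * quadf f t.2.2 d e.

(** The directional derivative of [cubicf] at (a, b, d, e) along (a', b', d', e'). *)
Definition dcubicf (R : comNzRingType) (f : trit -> R) (t : tform)
    (a b d e a' b' d' e' : R) : R :=
  let: (((p0, r0, s0), (p1, r1, s1)), ((k0, l0, m0), (k1, l1, m1))) := t in
  a' * (d * (f p0 * (a + a) + f r0 * b) + e * (f p1 * (a + a) + f r1 * b)
        + quadf f t.2.1 d e)
  + b' * (d * (f r0 * a + f s0 * (b + b)) + e * (f r1 * a + f s1 * (b + b))
        + quadf f t.2.2 d e)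
  + d' * (a * (f k0 * (d + d) + f l0 * e) + b * (f k1 * (d + d) + f l1 * e)
        + quadf f t.1.1 a b)
  + e' * (a * (f l0 * d + f m0 * (e + e)) + b * (f l1 * d + f m1 * (e + e))
        + quadf f t.1.2 a b).

Lemma cubicf_line (R : comNzRingType) (f : trit -> R) t (X a b d e a' b' d' e' : R) :
  cubicf f t (X * a + a') (X * b + b') (X * d + d') (X * e + e') =
  cubicf f t a b d e * X ^+ 3 + dcubicf f t a b d e a' b' d' e' * X ^+ 2
  + dcubicf f t a' b' d' e' a b d e * X + cubicf f t a' b' d' e'.
Proof.
case: t => [[[[p0 r0] s0] [[p1 r1] s1]] [[[k0 l0] m0] [[k1 l1] m1]]].
rewrite /cubicf /dcubicf /quadf /=; ring.
Qed.

Lemma cubicf_swap (R : comNzRingType) (f : trit -> R) t (a b d e : R) :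
  cubicf f t a b d e = cubicf f (t.2, t.1) d e a b.
Proof. by rewrite /cubicf /= -addrA addrC addrA. Qed.

(** * Expansion of a cubic in a basis *)

Definition rpt (y0 y1 y2 y3 : 'F_3) (u v w z : 'rV['F_3]_4) :=
  y0 *: u + y1 *: v + y2 *: w + y3 *: z.

(** An identity of forms, not of functions on F_3: quantifying over [R] and [f] lets one [t] serve
    over F_3, over its extensions and over polynomial rings. *)
Definition represents (c : cubic) (u v w z : 'rV['F_3]_4) (t : tform) : Prop :=
  forall (R : comNzRingType) (f : {rmorphism 'F_3 -> R}) (a b d e : R),
    evalC f c (fun i => a * f (u 0 i) + b * f (v 0 i) + d * f (w 0 i) + e * f (z 0 i))
    = cubicf (f \o F3) t a b d e.

Definition polar (c : cubic) (x y z : 'rV['F_3]_4) : 'F_3 :=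
  \sum_(i < 4) \sum_(j < 4) \sum_(k < 4) c i j k * (x 0 i * y 0 j * z 0 k).

Lemma evalC_comb (c : cubic) (m : 'I_4 -> 'rV['F_3]_4) (R : comNzRingType)
    (f : {rmorphism 'F_3 -> R}) (y : 'I_4 -> R) :
  evalC f c (fun i => \sum_p y p * f (m p 0 i)) =
  \sum_p \sum_q \sum_r f (polar c (m p) (m q) (m r)) * (y p * y q * y r).
Proof.
have fpolar p q r : f (polar c (m p) (m q) (m r)) * (y p * y q * y r) =
    \sum_i \sum_j \sum_k f (c i j k) *
      ((y p * f (m p 0 i)) * (y q * f (m q 0 j)) * (y r * f (m r 0 k))).
  rewrite rmorph_sum mulr_suml; apply: eq_bigr => i _.
  rewrite rmorph_sum mulr_suml; apply: eq_bigr => j _.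
  rewrite rmorph_sum mulr_suml; apply: eq_bigr => k _.
  by rewrite !rmorphM; ring.
under [RHS]eq_bigr => p _ do under eq_bigr => q _ do under eq_bigr => r _ do
  rewrite fpolar.
rewrite /evalC.
(* The sum over [i] moves outward past [r], [q] and [p]; then the same is done for [j] and [k]. *)
under [RHS]eq_bigr => p _ do under eq_bigr => q _ do rewrite exchange_big.
under [RHS]eq_bigr => p _ do rewrite exchange_big.
rewrite [RHS]exchange_big /=; apply: eq_bigr => i _.
under [RHS]eq_bigr => p _ do under eq_bigr => q _ do rewrite exchange_big.
under [RHS]eq_bigr => p _ do rewrite exchange_big.
rewrite [RHS]exchange_big /=; apply: eq_bigr => j _.
under [RHS]eq_bigr => p _ do under eq_bigr => q _ do rewrite exchange_big.
under [RHS]eq_bigr => p _ do rewrite exchange_big.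
rewrite [RHS]exchange_big /=; apply: eq_bigr => k _.
rewrite big_distrlr /= mulr_suml mulr_sumr; apply: eq_bigr => p _.
rewrite mulr_suml mulr_sumr; apply: eq_bigr => q _.
by rewrite !mulr_sumr.
Qed.

(** [polar] need not be symmetric, so the coefficient of a mixed monomial is a sum over the
    arrangements of its arguments. *)
Definition polar21 c x y := polar c x x y + polar c x y x + polar c y x x.

Definition polar111 c x y z :=
  polar c x y z + polar c x z y + polar c y x z + polar c y z x
  + polar c z x y + polar c z y x.

Definition binary_cubic (c : cubic) (R : comNzRingType) (f : 'F_3 -> R)
    (x y : 'rV['F_3]_4) (a b : R) : R :=
  f (polar c x x x) * a ^+ 3 + f (polar21 c x y) * (a ^+ 2 * b)
  + f (polar21 c y x) * (a * b ^+ 2) + f (polar c y y y) * b ^+ 3.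

Lemma evalC_basis c (u v w z : 'rV['F_3]_4) (R : comNzRingType)
    (f : {rmorphism 'F_3 -> R}) (a b d e : R) :
  evalC f c (fun i => a * f (u 0 i) + b * f (v 0 i) + d * f (w 0 i) + e * f (z 0 i)) =
  binary_cubic c f u v a b + binary_cubic c f w z d e
  + d * (f (polar21 c u w) * a ^+ 2 + f (polar111 c u v w) * (a * b)
         + f (polar21 c v w) * b ^+ 2)
  + e * (f (polar21 c u z) * a ^+ 2 + f (polar111 c u v z) * (a * b)
         + f (polar21 c v z) * b ^+ 2)
  + a * (f (polar21 c w u) * d ^+ 2 + f (polar111 c u w z) * (d * e)
         + f (polar21 c z u) * e ^+ 2)
  + b * (f (polar21 c w v) * d ^+ 2 + f (polar111 c v w z) * (d * e)
         + f (polar21 c z v) * e ^+ 2).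
Proof.
pose m (p : 'I_4) := nth 0 [:: u; v; w; z] p.
pose y (p : 'I_4) := nth 0 [:: a; b; d; e] p.
transitivity (evalC f c (fun i => \sum_p y p * f (m p 0 i))).
  rewrite /evalC; do 3!(apply: eq_bigr => ? _).
  by rewrite !big_ord_recr !big_ord0 /m /y /= !add0r.
rewrite evalC_comb !big_ord_recr !big_ord0 /m /y /= !add0r.
rewrite /binary_cubic /polar21 /polar111 !rmorphD; ring.
Qed.

Lemma line_polyE c (u v : 'rV['F_3]_4) :
  line_poly idF3 c u v = binary_cubic c (@polyC _) u v 'X 1.
Proof.
(* With the last two vectors and coordinates zero, only the binary cubic of [u] and [v] survives. *)
have := @evalC_basis c u v 0 0 _ (@polyC 'F_3 : {rmorphism 'F_3 -> {poly 'F_3}}) 'X 1 0 0.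
have B0 : binary_cubic c (@polyC 'F_3) 0 0 0 0 = 0 by rewrite /binary_cubic; ring.
rewrite !mul0r !addr0 B0 expr0n /= !mulr0 !addr0 !mulr0 !addr0 => E.
rewrite -E /line_poly /evalC; do 3!(apply: eq_bigr => ? _).
by rewrite /idF3 !mxE !mul0r !addr0 !mul1r.
Qed.

(** The coefficients of the polynomial are the four coefficients of the binary form, so these vanish
    and the form is zero over every ring. *)
Lemma binary_cubic0 c (u v : 'rV['F_3]_4) :
  line_poly idF3 c u v = 0 ->
  forall (R : comNzRingType) (f : {rmorphism 'F_3 -> R}) a b,
    binary_cubic c f u v a b = 0.
Proof.
rewrite line_polyE => p0 R f a b.
have co i : (binary_cubic c (@polyC _) u v 'X 1)`_i = 0 by rewrite p0 coef0.
move: (co 0%N) (co 1%N) (co 2%N) (co 3%N).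
rewrite /binary_cubic !expr1n !mulr1.
rewrite !coefD !coefCM !coefXn !coefX !coefC /= !mulr0 !mulr1 !add0r !addr0.
by move=> -> -> -> ->; rewrite !rmorph0; ring.
Qed.

(** The pure terms of each line drop out; the twelve mixed coefficients make up [t]. *)
Lemma exists_form c (u v w z : 'rV['F_3]_4) :
  line_in_S idF3 c u v -> line_in_S idF3 c w z ->
  exists t, represents c u v w z t.
Proof.
move=> [_ uv0] [_ wz0].
have [p0 P0] := F3_surj (polar21 c u w).
have [r0 R0] := F3_surj (polar111 c u v w).
have [s0 S0] := F3_surj (polar21 c v w).
have [p1 Q1] := F3_surj (polar21 c u z).
have [r1 R1] := F3_surj (polar111 c u v z).
have [s1 S1] := F3_surj (polar21 c v z).
have [k0 K0] := F3_surj (polar21 c w u).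
have [l0 L0] := F3_surj (polar111 c u w z).
have [m0 M0] := F3_surj (polar21 c z u).
have [k1 K1] := F3_surj (polar21 c w v).
have [l1 L1] := F3_surj (polar111 c v w z).
have [m1 M1] := F3_surj (polar21 c z v).
exists (((p0, r0, s0), (p1, r1, s1)), ((k0, l0, m0), (k1, l1, m1))).
move=> R f a b d e.
rewrite evalC_basis (binary_cubic0 uv0) (binary_cubic0 wz0) !add0r.
by rewrite P0 R0 S0 Q1 R1 S1 K0 L0 M0 K1 L1 M1.
Qed.

(** * Smoothness in coordinates *)

Definition indep4 (u v w z : 'rV['F_3]_4) : Prop :=
  forall a b d e, rpt a b d e u v w z = 0 -> [/\ a = 0, b = 0, d = 0 & e = 0].

Definition basis_mx (u v w z : 'rV['F_3]_4) : 'M['F_3]_4 :=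
  \matrix_(p, i) (nth 0 [:: u; v; w; z] p) 0 i.

Definition comb4 (L : fieldType) (f : 'F_3 -> L) (u v w z : 'rV['F_3]_4) (a b d e : L) :=
  a *: map_mx f u + b *: map_mx f v + d *: map_mx f w + e *: map_mx f z.

Lemma comb4E (L : fieldType) (f : 'F_3 -> L) u v w z a b d e i :
  comb4 f u v w z a b d e 0 i =
  a * f (u 0 i) + b * f (v 0 i) + d * f (w 0 i) + e * f (z 0 i).
Proof. by rewrite !mxE. Qed.

Lemma mul_basis_mx (L : fieldType) (f : {rmorphism 'F_3 -> L}) u v w z (y : 'rV[L]_4) :
  y *m map_mx f (basis_mx u v w z) =
  comb4 f u v w z (y 0 (inord 0)) (y 0 (inord 1)) (y 0 (inord 2)) (y 0 (inord 3)).
Proof.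
apply/rowP => i; rewrite comb4E !mxE !big_ord_recr big_ord0 /= !mxE /= add0r.
by do !congr (_ + _); congr (y 0 _ * _); apply: val_inj; rewrite /= inordK.
Qed.

Lemma comb4_row (L : fieldType) (f : {rmorphism 'F_3 -> L}) u v w z a b d e :
  comb4 f u v w z a b d e =
  (\row_p nth 0 [:: a; b; d; e] p) *m map_mx f (basis_mx u v w z).
Proof. by rewrite mul_basis_mx !mxE !inordK. Qed.

Lemma rptE u v w z a b d e : rpt a b d e u v w z = comb4 idfun u v w z a b d e.
Proof. by apply/rowP => i; rewrite !mxE. Qed.

Lemma basis_unit u v w z : indep4 u v w z -> basis_mx u v w z \in unitmx.
Proof.
move=> ind; rewrite -row_free_unit; apply: inj_row_free => y y0.
have := mul_basis_mx (idfun : {rmorphism 'F_3 -> 'F_3}) u v w z y.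
rewrite map_mx_id // y0 => /esym; rewrite -rptE => /ind[y0' y1 y2 y3].
apply/rowP => i; rewrite mxE -(inord_val i).
by case: i => [[|[|[|[|//]]]] lt_i].
Qed.

(** Independence over F_3 persists over [L] because an invertible matrix stays invertible. *)
Lemma comb4_inj (L : fieldType) (f : {rmorphism 'F_3 -> L}) u v w z a b d e :
  indep4 u v w z -> comb4 f u v w z a b d e = 0 ->
  [/\ a = 0, b = 0, d = 0 & e = 0].
Proof.
move=> /basis_unit Mu; rewrite comb4_row => y0.
have fMu : map_mx f (basis_mx u v w z) \in unitmx by rewrite map_unitmx.
have /rowP y00 : (\row_p nth 0 [:: a; b; d; e] p : 'rV[L]_4) = 0.
  by rewrite -(mulmxK fMu (\row_p _)) y0 mul0mx.
by split; [move: (y00 (inord 0)) | move: (y00 (inord 1)) | move: (y00 (inord 2))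
  | move: (y00 (inord 3))]; rewrite !mxE inordK.
Qed.

Lemma comb4_surj (L : fieldType) (f : {rmorphism 'F_3 -> L}) u v w z (x : 'rV[L]_4) :
  indep4 u v w z -> exists a b d e, x = comb4 f u v w z a b d e.
Proof.
move=> /basis_unit Mu.
have fMu : map_mx f (basis_mx u v w z) \in unitmx by rewrite map_unitmx.
have := mul_basis_mx f u v w z (x *m invmx (map_mx f (basis_mx u v w z))).
by rewrite mulmxKV // => ->; do 4!eexists.
Qed.

(** Reads a partial derivative as the linear coefficient along a coordinate direction, so that
    derivatives can be carried through a change of basis. *)
Lemma evalC_coef1 (L : fieldType) (f : 'F_3 -> L) c (m : 'I_4) (x : 'I_4 -> L) :
  (evalC (fun a => (f a)%:P) c (fun i => 'X * ((i == m)%:R)%:P + (x i)%:P))`_1 =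
  dC f c m x.
Proof.
rewrite /evalC /dC coef_sum; apply: eq_bigr => i _.
rewrite coef_sum; apply: eq_bigr => j _; rewrite coef_sum; apply: eq_bigr => k _.
rewrite coefCM; congr (_ * _).
move: (i == m)%:R (j == m)%:R (k == m)%:R => p q r.
set Q := _ * _.
(* Horner form, from which the coefficient of X can be read off. *)
have -> : Q = 'X * ('X * ('X * (p * q * r)%:P
    + (p * q * x k + p * r * x j + q * r * x i)%:P)
    + (p * (x j * x k) + q * (x i * x k) + r * (x i * x j))%:P)
    + (x i * x j * x k)%:P.
  by rewrite /Q !rmorphD !rmorphM; ring.
by rewrite coefD coefXM coefD coefXM !coefC /= add0r addr0.
Qed.

(** The Jacobian criterion in the coordinates of the basis: the partial derivative in direction [m]
    is [dcubicf] along the coordinates of the [m]-th standard vector. *)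
Lemma smooth_form c u v w z t (L : fieldExtType 'F_3) (a b d e : L) :
  smooth c -> indep4 u v w z -> represents c u v w z t ->
  cubicf (@emb L \o F3) t a b d e = 0 ->
  (forall a' b' d' e', dcubicf (@emb L \o F3) t a b d e a' b' d' e' = 0) ->
  [/\ a = 0, b = 0, d = 0 & e = 0].
Proof.
move=> Sc ind rep F0 dF0.
pose f : {rmorphism 'F_3 -> L} := in_alg L.
have [/(comb4_inj ind) //|x0] := eqVneq (comb4 f u v w z a b d e) 0.
case: (Sc L _ x0); split.
  rewrite -F0 -(rep _ f).
  by rewrite /evalC; do 3!(apply: eq_bigr => ? _); rewrite !mxE.
move=> m; rewrite -evalC_coef1.
have [a' [b' [d' [e' Em]]]] := comb4_surj f (delta_mx 0 m) ind.
(* [rep] is applied over L[X], and the coefficients of X on both sides are compared. *)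
pose g : {rmorphism 'F_3 -> {poly L}} := polyC \o f.
transitivity (evalC g c (fun i => ('X * a'%:P + a%:P) * g (u 0 i)
  + ('X * b'%:P + b%:P) * g (v 0 i) + ('X * d'%:P + d%:P) * g (w 0 i)
  + ('X * e'%:P + e%:P) * g (z 0 i)))`_1.
  apply: (congr1 (fun p : {poly L} => p`_1)).
  rewrite /evalC; do 3!(apply: eq_bigr => ? _).
  congr (_ * _); rewrite -!/(f _).
  have E i : 'X * ((i == m)%:R)%:P + (comb4 f u v w z a b d e 0 i)%:P =
    ('X * a'%:P + a%:P) * g (u 0 i) + ('X * b'%:P + b%:P) * g (v 0 i)
    + ('X * d'%:P + d%:P) * g (w 0 i) + ('X * e'%:P + e%:P) * g (z 0 i).
    have -> : (i == m)%:R = comb4 f u v w z a' b' d' e' 0 i by rewrite -Em mxE eqxx.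
    by rewrite !comb4E /g /= !rmorphD !rmorphM /=; ring.
  by rewrite !E.
rewrite rep cubicf_line.
have cubicfC a1 b1 d1 e1 : cubicf (g \o F3) t a1%:P b1%:P d1%:P e1%:P =
    (cubicf (f \o F3) t a1 b1 d1 e1)%:P.
  by case: (t) => [[[[? ?] ?] [[? ?] ?]] [[[? ?] ?] [[? ?] ?]]];
    rewrite /cubicf /quadf /= !rmorphD !rmorphM; ring.
have dcubicfC a1 b1 d1 e1 a2 b2 d2 e2 :
    dcubicf (g \o F3) t a1%:P b1%:P d1%:P e1%:P a2%:P b2%:P d2%:P e2%:P =
    (dcubicf (f \o F3) t a1 b1 d1 e1 a2 b2 d2 e2)%:P.
  by case: (t) => [[[[? ?] ?] [[? ?] ?]] [[[? ?] ?] [[? ?] ?]]];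
    rewrite /dcubicf /quadf /= !rmorphD !rmorphM; ring.
rewrite !cubicfC !dcubicfC dF0 F0 mul0r !addr0.
by rewrite coefD !coefCM !coefXn /= !mulr0 addr0.
Qed.

(** * Chords and tangents *)

Lemma evalCZ (R : comNzRingType) (f : 'F_3 -> R) c (k : R) (x : 'I_4 -> R) :
  evalC f c (fun i => k * x i) = k ^+ 3 * evalC f c x.
Proof.
rewrite /evalC mulr_sumr; apply: eq_bigr => i _.
rewrite mulr_sumr; apply: eq_bigr => j _; rewrite mulr_sumr; apply: eq_bigr => k' _.
ring.
Qed.

Lemma on_SKZ c R a : a != 0 -> on_SK c R -> on_SK c (a *: R).
Proof.
move=> a0 [R0 FR]; split; first by rewrite scaler_eq0 negb_or a0.
rewrite -[RHS](mulr0 (a ^+ 3)) -FR -evalCZ /evalC.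
by do 3!(apply: eq_bigr => ? _); rewrite !mxE.
Qed.

Lemma in_span_onSK c P0 R : on_SK c P0 -> in_span c P0 R -> on_SK c R.
Proof. by move=> SP0; case=> // a a0; apply: on_SKZ. Qed.

(** The span consists of vectors but is meant projectively. In a step, rescaling [R] multiplies its
    linear factor by [a], which [lam] absorbs. *)
Lemma in_spanZ c P0 R a : a != 0 -> in_span c P0 R -> in_span c P0 (a *: R).
Proof.
move=> a0 spR; case: spR a0 => [b b0 a0|P Q {}R spP spQ SR]; last move=> [u [v]].
  by rewrite scalerA; apply: span_base; rewrite mulf_neq0.
move=> [ind n0 [p1 [p2 [q1 [q2 [r1 [r2 [lam [EP EQ ER El]]]]]]]]] a0.
apply: (span_step spP spQ); first exact: on_SKZ.
exists u, v; split=> //.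
exists p1, p2, q1, q2, (a * r1), (a * r2), (lam * a^-1); split=> //.
  by rewrite ER scalerDr !scalerA.
have aV : (a%:P * (a^-1)%:P = 1 :> {poly 'F_3}) by rewrite -rmorphM mulfV.
rewrite El !rmorphM; set l := lam%:P; set Y := (_ - _) * (_ - _).
transitivity (l * (Y * (r2%:P * 'X - r1%:P)) * (a%:P * (a^-1)%:P)).
  by rewrite aV mulr1.
ring.
Qed.

(** If [Q] were k P, the restriction would be (X + k)^3 F(P), which is zero since [P] lies on the
    surface. *)
Lemma line_poly_indep c P Q :
  on_SK c P -> line_poly idF3 c P Q != 0 -> independent P Q.
Proof.
move=> [P0 FP] /eqP n0 a b.
have [->|b0] := eqVneq b 0.
  by rewrite scale0r addr0 => /eqP; rewrite scaler_eq0 (negbTE P0) orbF => /eqP.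
move=> E; case: n0.
have EQ : Q = (- (b^-1 * a)) *: P.
  apply: (scalerI b0); rewrite scalerA mulrN mulrA mulfV // mul1r scaleNr.
  by apply/eqP; rewrite -addr_eq0 addrC E.
set k := - _ in EQ.
transitivity (('X + k%:P) ^+ 3 * (evalC (fun a => (idF3 a)%:P) c (fun i => (P 0 i)%:P))).
  rewrite -evalCZ /line_poly /evalC; do 3!(apply: eq_bigr => ? _).
  by rewrite EQ !mxE !rmorphM /idF3; ring.
have -> : evalC (fun a => (idF3 a)%:P) c (fun i => (P 0 i)%:P) =
    (evalC idF3 c (fun i => P 0 i))%:P.
  rewrite /evalC !rmorph_sum; apply: eq_bigr => i _.
  rewrite !rmorph_sum; apply: eq_bigr => j _.
  by rewrite !rmorph_sum; apply: eq_bigr => l _; rewrite !rmorphM.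
by rewrite FP mulr0.
Qed.

(** The restriction is s t (c2 s + c1 t), whose third root is s = - c1, t = c2. *)
Lemma span_chord c P0 P Q R c1 c2 :
  on_SK c P0 -> in_span c P0 P -> in_span c P0 Q -> on_SK c R ->
  line_poly idF3 c P Q = c2%:P * 'X ^+ 2 + c1%:P * 'X ->
  R = - c1 *: P + c2 *: Q -> in_span c P0 R.
Proof.
move=> S0 spP spQ SR E ER.
(* Otherwise c1 = c2 = 0 and [R] would be the zero vector. *)
have n0 : line_poly idF3 c P Q != 0.
  apply/eqP => E0; case: SR => /eqP[]; rewrite ER.
  have coE i : (line_poly idF3 c P Q)`_i = (c2%:P * 'X ^+ 2 + c1%:P * 'X)`_i by rewrite E.
  move: (coE 1%N) (coE 2%N); rewrite E0 !coef0 !coefD !coefCM.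
  rewrite !coefXn !coefX /= !mulr0 !mulr1 add0r addr0.
  by move=> <- <-; rewrite oppr0 !scale0r addr0.
apply: (span_step spP spQ SR); exists P, Q; split=> //.
  exact: line_poly_indep (in_span_onSK S0 spP) n0.
(* The linear factor of [P] is the constant -1, which the scalar -1 offsets. *)
exists 1, 0, 0, 1, (- c1), c2, (- 1); split=> //;
  rewrite ?scale1r ?scale0r ?addr0 ?add0r //.
by rewrite E !rmorphN !rmorph1 !rmorph0; ring.
Qed.

(** The restriction is t^2 (c1 s + c0 t), with a double root at [P]. The point [Q] only fixes the
    tangent direction and may lie off the surface. *)
Lemma span_tangent c P0 P Q R c0 c1 :
  on_SK c P0 -> in_span c P0 P -> on_SK c R ->
  line_poly idF3 c P Q = c1%:P * 'X + c0%:P ->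
  R = - c0 *: P + c1 *: Q -> in_span c P0 R.
Proof.
move=> S0 spP SR E ER.
have n0 : line_poly idF3 c P Q != 0.
  apply/eqP => E0; case: SR => /eqP[]; rewrite ER.
  have coE i : (line_poly idF3 c P Q)`_i = (c1%:P * 'X + c0%:P)`_i by rewrite E.
  move: (coE 0%N) (coE 1%N); rewrite E0 !coef0 !coefD !coefCM.
  rewrite !coefX !coefC /= !mulr0 !mulr1 add0r addr0.
  by move=> <- <-; rewrite oppr0 !scale0r addr0.
apply: (span_step spP spP SR); exists P, Q; split=> //.
  exact: line_poly_indep (in_span_onSK S0 spP) n0.
exists 1, 0, 1, 0, (- c0), c1, 1; split=> //;
  rewrite ?scale1r ?scale0r ?addr0 ?add0r //.
by rewrite E !rmorphN !rmorph1 !rmorph0; ring.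
Qed.

(** * Values, gradients and points in trit coordinates *)

Inductive tvec := V4 of trit & trit & trit & trit.

Definition tquadv (q : tquad) a b :=
  let: (p, r, s) := q in
  tadd (tmul p (tmul a a)) (tadd (tmul r (tmul a b)) (tmul s (tmul b b))).

Definition tdot x y :=
  let: V4 a b d e := x in let: V4 a' b' d' e' := y in
  tadd (tadd (tmul a a') (tmul b b')) (tadd (tmul d d') (tmul e e')).

Definition tpolar (q : tquad) a b :=
  let: (p, r, s) := q in
  (tadd (tmul p (tadd a a)) (tmul r b), tadd (tmul r a) (tmul s (tadd b b))).

Definition teval (t : tform) x :=
  let: V4 a b d e := x in
  tadd (tadd (tmul d (tquadv t.1.1 a b)) (tmul e (tquadv t.1.2 a b)))
       (tadd (tmul a (tquadv t.2.1 d e)) (tmul b (tquadv t.2.2 d e))).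

Definition tgrad (t : tform) x :=
  let: V4 a b d e := x in
  let: (pa, pb) := tpolar t.1.1 a b in let: (qa, qb) := tpolar t.1.2 a b in
  let: (pd, pe) := tpolar t.2.1 d e in let: (qd, qe) := tpolar t.2.2 d e in
  V4 (tadd (tadd (tmul d pa) (tmul e qa)) (tquadv t.2.1 d e))
     (tadd (tadd (tmul d pb) (tmul e qb)) (tquadv t.2.2 d e))
     (tadd (tadd (tmul a pd) (tmul b qd)) (tquadv t.1.1 a b))
     (tadd (tadd (tmul a pe) (tmul b qe)) (tquadv t.1.2 a b)).

Lemma tevalE t a b d e :
  cubicf F3 t (F3 a) (F3 b) (F3 d) (F3 e) = F3 (teval t (V4 a b d e)).
Proof.
case: t => [[[[? ?] ?] [[? ?] ?]] [[[? ?] ?] [[? ?] ?]]].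
by rewrite /cubicf /teval /quadf /tquadv /= !(F3D, F3M); ring.
Qed.

Lemma tgradE t a b d e a' b' d' e' :
  dcubicf F3 t (F3 a) (F3 b) (F3 d) (F3 e) (F3 a') (F3 b') (F3 d') (F3 e') =
  F3 (tdot (tgrad t (V4 a b d e)) (V4 a' b' d' e')).
Proof.
case: t => [[[[? ?] ?] [[? ?] ?]] [[[? ?] ?] [[? ?] ?]]].
by rewrite /dcubicf /quadf /tquadv /= !(F3D, F3M); ring.
Qed.

Definition vpt (u v w z : 'rV['F_3]_4) (x : tvec) : 'rV['F_3]_4 :=
  let: V4 a b d e := x in rpt (F3 a) (F3 b) (F3 d) (F3 e) u v w z.

Lemma vpt_surj u v w z R : indep4 u v w z -> exists x, R = vpt u v w z x.
Proof.
move=> ind.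
have [a [b [d [e ->]]]] := comb4_surj (idfun : {rmorphism 'F_3 -> 'F_3}) R ind.
have [a' ->] := F3_surj a; have [b' ->] := F3_surj b.
have [d' ->] := F3_surj d; have [e' ->] := F3_surj e.
by exists (V4 a' b' d' e'); rewrite /vpt rptE.
Qed.

Definition tvzero x := let: V4 a b d e := x in [&& tzero a, tzero b, tzero d & tzero e].

Lemma vpt_eq0 u v w z x : indep4 u v w z -> (vpt u v w z x == 0) = tvzero x.
Proof.
case: x => a b d e ind; apply/eqP/idP => [/ind[a0 b0 d0 e0]|] /=.
  by rewrite -!F3_eq0 a0 b0 d0 e0 eqxx.
case: a b d e => [] [] [] [] // _.
by rewrite /rpt /= !scale0r !addr0.
Qed.

Lemma evalC_vpt c u v w z t x : represents c u v w z t ->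
  evalC idF3 c (fun i => vpt u v w z x 0 i) = F3 (teval t x).
Proof.
move=> rep; case: x => a b d e; rewrite -tevalE.
rewrite -(rep _ (idfun : {rmorphism 'F_3 -> 'F_3})).
by rewrite /evalC; do 3!(apply: eq_bigr => ? _); rewrite !mxE.
Qed.

Lemma on_SK_vpt c u v w z t x : represents c u v w z t -> indep4 u v w z ->
  on_SK c (vpt u v w z x) <-> tzero (teval t x) && ~~ tvzero x.
Proof.
move=> rep ind; rewrite /on_SK (evalC_vpt _ rep) vpt_eq0 // -F3_eq0.
by split=> [[-> ->]|/andP[/eqP -> ->]]; rewrite ?eqxx.
Qed.

Lemma line_poly_vpt c u v w z t x y : represents c u v w z t ->
  line_poly idF3 c (vpt u v w z x) (vpt u v w z y) =
  (F3 (teval t x))%:P * 'X ^+ 3 + (F3 (tdot (tgrad t x) y))%:P * 'X ^+ 2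
  + (F3 (tdot (tgrad t y) x))%:P * 'X + (F3 (teval t y))%:P.
Proof.
case: x y => a b d e [a' b' d' e'] rep; rewrite -!tevalE -!tgradE.
pose g : {rmorphism 'F_3 -> {poly 'F_3}} := @polyC 'F_3.
transitivity (evalC g c (fun i => ('X * g (F3 a) + g (F3 a')) * g (u 0 i)
  + ('X * g (F3 b) + g (F3 b')) * g (v 0 i) + ('X * g (F3 d) + g (F3 d')) * g (w 0 i)
  + ('X * g (F3 e) + g (F3 e')) * g (z 0 i))).
  have E i : 'X * (vpt u v w z (V4 a b d e) 0 i)%:P
      + (vpt u v w z (V4 a' b' d' e') 0 i)%:P =
    ('X * g (F3 a) + g (F3 a')) * g (u 0 i)
  + ('X * g (F3 b) + g (F3 b')) * g (v 0 i) + ('X * g (F3 d) + g (F3 d')) * g (w 0 i)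
  + ('X * g (F3 e) + g (F3 e')) * g (z 0 i).
    by rewrite /vpt !mxE /g /= !rmorphD !rmorphM; ring.
  by rewrite /line_poly /evalC; do 3!(apply: eq_bigr => ? _); rewrite !E.
rewrite rep cubicf_line /g.
by case: (t) => [[[[? ?] ?] [[? ?] ?]] [[[? ?] ?] [[? ?] ?]]];
    rewrite /cubicf /dcubicf /quadf /= !rmorphD !rmorphM; ring.
Qed.

(** * Computing spans *)

Definition teq x y :=
  match x, y with T0, T0 | T1, T1 | T2, T2 => true | _, _ => false end.

(** Nested conditionals avoid the eager evaluation of both arguments of [&&] under call by value. *)
Definition tveq x y :=
  let: V4 a b d e := x in let: V4 a' b' d' e' := y in
  if teq a a' then if teq b b' then if teq d d' then teq e e' else false else false
  else false.

Definition tvopp x := let: V4 a b d e := x in V4 (topp a) (topp b) (topp d) (topp e).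

Definition tnorm x :=
  match x with
  | V4 T2 _ _ _ | V4 T0 T2 _ _ | V4 T0 T0 T2 _ | V4 T0 T0 T0 T2 => tvopp x
  | _ => x
  end.

Definition tvcomb k x l y :=
  let: V4 a b d e := x in let: V4 a' b' d' e' := y in
  V4 (tadd (tmul k a) (tmul l a')) (tadd (tmul k b) (tmul l b'))
     (tadd (tmul k d) (tmul l d')) (tadd (tmul k e) (tmul l e')).

Definition trits := [:: T0; T1; T2].

Definition tpairs := [seq (d, e) | d <- trits, e <- trits].

(** The 40 points of P^3(F_3), each by its vector with first nonzero coordinate 1. *)
Definition tpoints : seq tvec :=
  [seq V4 T1 b p.1 p.2 | b <- trits, p <- tpairs]
  ++ [seq V4 T0 T1 p.1 p.2 | p <- tpairs]
  ++ [seq V4 T0 T0 T1 e | e <- trits] ++ [:: V4 T0 T0 T0 T1].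

Fixpoint textract x (s : seq tvec) : option (tvec * seq tvec) :=
  if s is y :: s' then
    if tveq x y then Some (y, s')
    else if textract x s' is Some (p, s'') then Some (p, y :: s'') else None
  else None.

(* A worklist entry [(x, g)] is a point together with its gradient. *)
Definition tchord (p q : tvec * tvec) : tvec :=
  tnorm (tvcomb (topp (tdot q.2 p.1)) p.1 (tdot p.2 q.1) q.1).

Definition ttangent t (p q : tvec * tvec) : tvec :=
  tnorm (tvcomb (topp (teval t q.1)) p.1 (tdot q.2 p.1) q.1).

(** A candidate absent from the remaining points changes nothing: it is zero, because its line lies
    in the surface or its two points coincide, or it has been reached already. *)
Definition tabsorb t (st : seq (tvec * tvec) * seq tvec) x :=
  if textract x st.2 is Some (y, rem) then ((y, tgrad t y) :: st.1, rem) else st.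

(** The filter keeps the points of the tangent plane at [p], which give the tangent directions. *)
Definition tcands t (dat don : seq (tvec * tvec)) (p : tvec * tvec) :=
  [seq tchord p q | q <- don]
  ++ [seq ttangent t p q | q <- [seq q <- dat | tzero (tdot p.2 q.1)]].

(* [don] and [todo] are points of the span, and every tangent at a point of
   [don] and every chord of [don] has been tried; [rem] are the points not
   reached yet. *)
Fixpoint tgrow t dat n (don todo : seq (tvec * tvec)) (rem : seq tvec) : bool :=
  match rem, n, todo with
  | [::], _, _ => true
  | _, n'.+1, p :: todo' =>
      let: (todo'', rem') := foldl (tabsorb t) (todo', rem) (tcands t dat don p) in
      tgrow t dat n' (p :: don) todo'' rem'
  | _, _, _ => false
  end.

(** Gradients are tabulated once. Each round finishes one point, so 40 rounds, the number of points
    of P^3(F_3), suffice. *)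
Definition tspans t x : bool :=
  let dat := [seq (y, tgrad t y) | y <- tpoints] in
  if textract x [seq y <- tpoints | tzero (teval t y)] is Some (y, rem) then
    tgrow t dat 40 [::] [:: (y, tgrad t y)] rem
  else false.

Lemma tveqP x y : tveq x y -> x = y.
Proof. by move: x y => [[] [] [] []] [[] [] [] []]. Qed.

(** Membership is [List.In] throughout, as [trit] and [tvec] carry no equality structure. *)
Lemma textractP (A : tvec -> Prop) x s y rem :
  textract x s = Some (y, rem) ->
  (forall r, List.In r s -> A r) -> A y /\ forall r, List.In r rem -> A r.
Proof.
elim: s rem => // r s IH rem /=; case: ifP => [_ [<- <-] As|_].
  by split=> [|r' r'_s]; apply: As; [left | right].
case: textract IH => // -[y' rem'] IH [y'y <-] As; subst y'.
have [|Ay Arem] := IH _ erefl; first by move=> r' r'_s; apply: As; right.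
by split=> // r' /= [<-|/Arem //]; apply: As; left.
Qed.

Lemma textract_In x s y rem : textract x s = Some (y, rem) ->
  x = y /\ forall r, List.In r s -> r = y \/ List.In r rem.
Proof.
elim: s rem => // r s IH rem /=; case: ifP => [/tveqP -> [-> <-]|_].
  by split=> // r' [->|]; [left | right].
case: textract IH => // -[y' rem'] IH [y'y <-]; subst y'.
have [-> cov] := IH _ erefl; split=> // r' [->|/cov[->|]]; first by right; left.
  by left.
by right; right.
Qed.

Lemma vpt_opp u v w z x : vpt u v w z (tvopp x) = - vpt u v w z x.
Proof. by case: x => a b d e; rewrite /vpt /rpt /= !F3N !scaleNr !opprD. Qed.

Lemma tnormE x : tnorm x = x \/ tnorm x = tvopp x.
Proof.
by case: x => [[] [] [] []]; first [left; reflexivity | right; reflexivity].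
Qed.

Lemma tnorm_point x : ~~ tvzero x -> List.In (tnorm x) tpoints.
Proof. by case: x => [[] [] [] []] //= _; tauto. Qed.

Lemma vpt_comb u v w z k x l y :
  vpt u v w z (tvcomb k x l y) = F3 k *: vpt u v w z x + F3 l *: vpt u v w z y.
Proof.
case: x y => a b d e [a' b' d' e']; rewrite /vpt /rpt /= !F3D !F3M.
by apply/rowP => i; rewrite !mxE; ring.
Qed.

Section Soundness.
Context (c : cubic) (u v w z : 'rV['F_3]_4) (t : tform) (P0 : 'rV['F_3]_4).
Context (rep : represents c u v w z t) (ind : indep4 u v w z) (SP0 : on_SK c P0).

Let reached x := in_span c P0 (vpt u v w z x).
Let on_S x := on_SK c (vpt u v w z x).
Let known (p : tvec * tvec) := reached p.1 /\ p.2 = tgrad t p.1.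

Lemma reached_norm x : reached (tnorm x) <-> reached x.
Proof.
case: (tnormE x) => ->; first by [].
rewrite /reached vpt_opp -scaleN1r; split=> /(in_spanZ (a := -1)); last by apply.
by rewrite scalerA mulrNN mulr1 scale1r; apply.
Qed.

Lemma reached_teval x : reached x -> F3 (teval t x) = 0.
Proof. by move=> /(in_span_onSK SP0)[_]; rewrite (evalC_vpt _ rep). Qed.

Lemma on_S_norm x : on_S (tnorm x) -> on_S x.
Proof.
case: (tnormE x) => ->; first by [].
by rewrite /on_S vpt_opp => /(on_SKZ (a := -1)); rewrite scaleN1r opprK; apply.
Qed.

Lemma tchord_reached p q : known p -> known q -> on_S (tchord p q) ->
  reached (tchord p q).
Proof.
case: p q => x g [y h] [/= rx ->] [/= ry ->]; rewrite /tchord /= => /on_S_norm.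
set r := tvcomb _ _ _ _ => Sr; apply/reached_norm.
apply: (@span_chord _ _ (vpt u v w z x) (vpt u v w z y) _
  (F3 (tdot (tgrad t y) x)) (F3 (tdot (tgrad t x) y))) => //.
  by rewrite (line_poly_vpt _ _ rep) !reached_teval // mul0r add0r addr0.
by rewrite vpt_comb F3N.
Qed.

Lemma ttangent_reached p q : known p -> q.2 = tgrad t q.1 ->
  tzero (tdot p.2 q.1) -> on_S (ttangent t p q) -> reached (ttangent t p q).
Proof.
case: p q => x g [y h] [/= rx ->] /= ->; rewrite /ttangent /= => d0 /on_S_norm.
set r := tvcomb _ _ _ _ => Sr; apply/reached_norm.
apply: (@span_tangent _ _ (vpt u v w z x) (vpt u v w z y) _
  (F3 (teval t y)) (F3 (tdot (tgrad t y) x))) => //.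
  rewrite (line_poly_vpt _ _ rep) reached_teval //.
  by move: d0; rewrite -F3_eq0 => /eqP ->; rewrite !mul0r !add0r.
by rewrite vpt_comb F3N.
Qed.

(** The last conclusion is an invariant read backwards: a removed point has been reached, so it
    suffices to reach those that remain. Membership in [rem] supplies the [on_S x] that the first
    hypothesis asks for. *)
Lemma tabsorb_sound todo rem todo' rem' x :
  (on_S x -> reached x) ->
  (forall p, List.In p todo -> known p) -> (forall y, List.In y rem -> on_S y) ->
  tabsorb t (todo, rem) x = (todo', rem') ->
  [/\ forall p, List.In p todo' -> known p, forall y, List.In y rem' -> on_S y &
      (forall y, List.In y rem' -> reached y) -> forall y, List.In y rem -> reached y].
Proof.
rewrite /tabsorb /= => rx todoP remP.
case E: textract => [[y r]|] [<- <-] //.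
have [Sy rS] := textractP E remP; have [xy cov] := textract_In E.
have ry : reached y by move: rx; rewrite xy; apply.
split=> // [p [<-|/todoP] //|rr y' /cov [-> //|/rr //]].
Qed.

Lemma tabsorbs_sound s todo rem todo' rem' :
  (forall x, List.In x s -> on_S x -> reached x) ->
  (forall p, List.In p todo -> known p) -> (forall y, List.In y rem -> on_S y) ->
  foldl (tabsorb t) (todo, rem) s = (todo', rem') ->
  [/\ forall p, List.In p todo' -> known p, forall y, List.In y rem' -> on_S y &
      (forall y, List.In y rem' -> reached y) -> forall y, List.In y rem -> reached y].
Proof.
elim: s todo rem => [|x s IH] todo rem sP todoP remP /=; first by case=> <- <-.
case E: (tabsorb t (todo, rem) x) => [todo1 rem1] foldE.
have [|todo1P rem1P cov1] := tabsorb_sound _ todoP remP E.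
  by apply: sP; left.
have [|todo2P rem2P cov2] := IH _ _ _ todo1P rem1P foldE.
  by move=> y ys; apply: sP; right.
by split=> // /cov2 /cov1.
Qed.

Lemma In_map_seq (A B : Type) (f : A -> B) s y :
  List.In y [seq f x | x <- s] -> exists2 x, List.In x s & y = f x.
Proof.
elim: s => //= x s IH [<-|/IH[x' x's ->]]; first by exists x => //; left.
by exists x' => //; right.
Qed.

Lemma In_filter_seq (A : Type) (f : pred A) s y :
  List.In y [seq x <- s | f x] <-> List.In y s /\ f y.
Proof.
elim: s => [|x s IH] /=; first by split=> // -[].
case: ifP => fx /=; split.
- by move=> [<-|/IH[]]; split; auto.
- by move=> [[->|ys] fy]; [left | right; apply/IH].
- by move=> /IH[]; split; auto.
- by move=> [[yx|ys] fy]; [rewrite -yx fx in fy | apply/IH].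
Qed.

Lemma tgrow_sound dat n don todo rem :
  (forall q, List.In q dat -> q.2 = tgrad t q.1) ->
  (forall p, List.In p don -> known p) -> (forall p, List.In p todo -> known p) ->
  (forall y, List.In y rem -> on_S y) ->
  tgrow t dat n don todo rem -> forall y, List.In y rem -> reached y.
Proof.
move=> datP; elim: n don todo rem => [|n IH] don [|p todo] [|y0 rem] // donP todoP remP.
rewrite [tgrow _ _ _ _ _ _]/=.
case E: (foldl _ _ _) => [todo' rem'] grow_ok.
have kp : known p by apply: todoP; left.
have [||todo'P rem'P cov] := tabsorbs_sound _ _ remP E.
- move=> x; rewrite /tcands => x_cand.
  have [x_cand1|x_cand2] := List.in_app_or _ _ _ x_cand.
    have [q qs ->] := In_map_seq x_cand1.
    by apply: tchord_reached => //; apply: donP.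
  have [q /In_filter_seq[/datP gq d0] ->] := In_map_seq x_cand2.
  exact: ttangent_reached.
- by move=> q qs; apply: todoP; right.
apply: cov; apply: IH grow_ok => // q [<-|/donP] //.
Qed.

Lemma tspans_sound x : P0 = vpt u v w z x -> tspans t x ->
  forall R, in_span c P0 R <-> on_SK c R.
Proof.
move=> P0x; rewrite /tspans.
case E: textract => [[y rem]|] // grow_ok R; split; first exact: in_span_onSK.
have ptsP r : List.In r [seq y <- tpoints | tzero (teval t y)] -> on_S r.
  move=> /In_filter_seq[r_pts r0]; apply/(on_SK_vpt _ rep ind); rewrite r0 /=.
  have: List.Forall (fun r => ~~ tvzero r) tpoints by repeat constructor.
  by move=> /List.Forall_forall; apply.
have [Sy remP] := textractP E ptsP; have [xy cov] := textract_In E.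
have ry : reached y.
  by rewrite /reached -xy -P0x -[X in in_span _ _ X]scale1r; apply: span_base.
(* The enumeration has one vector per projective point, so [R] is replaced by its normalized
   multiple. *)
have [x' ->] := vpt_surj R ind => SR; apply/reached_norm.
have S'R : on_S (tnorm x').
  case: (tnormE x') => ->; rewrite /on_S ?vpt_opp -?scaleN1r //.
  exact: on_SKZ.
have /andP[ev0 nz] := (on_SK_vpt _ rep ind).1 S'R.
have nz' : ~~ tvzero x' by have /andP[] := (on_SK_vpt _ rep ind).1 SR.
have /cov[-> //|] : List.In (tnorm x') [seq y <- tpoints | tzero (teval t y)].
  by apply/In_filter_seq; split=> //; apply: tnorm_point.
apply: (tgrow_sound _ _ _ _ grow_ok) => //.
- by move=> q q_dat; have [q' _ ->] := In_map_seq q_dat.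
- by move=> q [<-|].
Qed.

End Soundness.

(** * The finite case analysis *)

Definition tpencil := (tquad * tquad)%type.

(* Unlike [has], [tsome] stops at the first success under call by value. *)
Fixpoint tsome (A : Type) (f : A -> bool) (s : seq A) : bool :=
  if s is x :: s' then if f x then true else tsome f s' else false.

Lemma tsomeP A (f : A -> bool) s : tsome f s -> exists2 x, List.In x s & f x.
Proof.
elim: s => //= x s IH; case: ifP => [fx _|_ /IH[y ys fy]]; first by exists x; auto.
by exists y; auto.
Qed.

Definition tquads : seq tquad := [seq (p.1, p.2, s) | p <- tpairs, s <- trits].
Definition tpencils : seq tpencil := [seq (p, q) | p <- tquads, q <- tquads].

Definition tqeq (p q : tquad) :=
  let: (a, b, d) := p in let: (a', b', d') := q in
  if teq a a' then if teq b b' then teq d d' else false else false.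

Definition tpeq (A B : tpencil) := if tqeq A.1 B.1 then tqeq A.2 B.2 else false.

Definition tqlin k (p : tquad) l (q : tquad) : tquad :=
  let: (a, b, d) := p in let: (a', b', d') := q in
  (tadd (tmul k a) (tmul l a'), tadd (tmul k b) (tmul l b'), tadd (tmul k d) (tmul l d')).

Definition tirred s : tquad := (T1, tadd s s, tadd (tmul s s) T1).

(* The irreducible binary quadratic forms over F_3 are, up to a scalar, the
   [tirred s] = (a + s b)^2 + b^2, with root [i - s]. *)
Definition tbad (A : tpencil) : bool :=
  if tsome (fun p => if tzero (tquadv A.1 p.1 p.2)
                     then tzero (tquadv A.2 p.1 p.2) else false)
       [:: (T1, T0); (T0, T1); (T1, T1); (T1, T2)]
  then true else
  tsome (fun s => tsome (fun p => let q := tirred s in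
      tpeq A (tqlin p.1 q T0 q, tqlin p.2 q T0 q)) tpairs) trits.

(* [V4 x y x' y'] also denotes the matrix with rows (x, y) and (x', y'). *)
Definition tdet (g : tvec) :=
  let: V4 x y x' y' := g in tadd (tmul x y') (topp (tmul y x')).

Definition tqsub (q : tquad) (g : tvec) : tquad :=
  let: (p, r, s) := q in let: V4 x y x' y' := g in
  (tquadv q x y,
   tadd (tmul (tadd p p) (tmul x x'))
     (tadd (tmul r (tadd (tmul x y') (tmul x' y))) (tmul (tadd s s) (tmul y y'))),
   tquadv q x' y').

Definition tpsub (A : tpencil) (g h : tvec) : tpencil :=
  let p := tqsub A.1 g in let q := tqsub A.2 g in
  let: V4 x y x' y' := h in (tqlin x p y q, tqlin x' p y' q).

(* The two types of pencils without common root: as a map of degree 2 from the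
   first line to the second, the ramification points are rational or conjugate. *)
Definition tsplit : tpencil := ((T1, T0, T0), (T0, T0, T1)).
Definition tnonsplit : tpencil := ((T1, T0, T2), (T0, T1, T0)).

(* For a pencil without common root, one of these changes of basis of the first
   line followed by some change of basis of the second one reaches [tsplit] or
   [tnonsplit]. *)
Definition tcosets : seq tvec :=
  [:: V4 T0 T1 T1 T0; V4 T0 T1 T1 T1; V4 T0 T1 T1 T2; V4 T1 T0 T1 T1;
      V4 T1 T0 T1 T2; V4 T1 T1 T1 T2].

Definition tmats : seq tvec :=
  [seq g <- [seq V4 p.1 p.2 q.1 q.2 | p <- tpairs, q <- tpairs] | ~~ tzero (tdet g)].

Definition treducible (A : tpencil) : bool :=
  tsome (fun g => tsome (fun h => let B := tpsub A g h in
     if tpeq B tsplit then true else tpeq B tnonsplit) tmats) tcosets.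

(** A pencil without common root is a map of degree 2, determined up to the basis of the second line
    by its two ramification points. The rows of the matrices in [tcosets] run through the six pairs
    of rational points; the same matrices suffice for the three conjugate pairs. *)
Lemma tpencils_reduce : all (fun A => if tbad A then true else treducible A) tpencils.
Proof. by vm_compute. Qed.

(** Together with the vanishing at [x], which [teckardt] tests, the first three conditions kill all
    four coefficients on the line; the last one is independence. *)
Definition tline t x y : bool :=
  [&& tzero (tdot (tgrad t x) y), tzero (tdot (tgrad t y) x), tzero (teval t y)
    & ~~ tsome (fun p => if tveq (V4 p.1 p.2 T0 T0) (V4 T0 T0 T0 T0) then false
                        else tvzero (tvcomb p.1 x p.2 y)) tpairs].

Definition tout x y x' : bool :=
  ~~ tsome (fun p => tveq x' (tvcomb p.1 x p.2 y)) tpairs.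

Definition teckardt t x y1 y2 y3 : bool :=
  [&& tzero (teval t x), [&& tline t x y1, tline t x y2 & tline t x y3]
    & [&& tout x y1 y2, tout x y1 y3 & tout x y2 y3]].

Definition te0 := V4 T1 T0 T0 T0.
Definition te1 := V4 T0 T1 T0 T0.
Definition te2 := V4 T0 T0 T1 T0.
Definition te3 := V4 T0 T0 T0 T1.

(* For [t.1 = tsplit], the tangent plane at [te0] is [d = 0]; if moreover
   [m0 = 0], it cuts the surface in [e * b * (b + m1 * e) = 0]. Similarly at [te1]. *)
Definition ttwo_eckardt (t : tform) : bool :=
  let: ((k0, _, _), (_, _, m1)) := t.2 in
  teckardt t te0 te1 te3 (V4 T0 (topp m1) T0 T1)
  && teckardt t te1 te0 te2 (V4 (topp k0) T0 T1 T0).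

(** In characteristic 3 Euler's relation does not put a zero of the gradient on the surface, so both
    are tested. *)
Definition tsingular t : bool :=
  tsome (fun x => if tzero (teval t x) then tvzero (tgrad t x) else false) tpoints.

Definition tstart t x : bool :=
  if tzero (teval t x) then if tvzero x then false else tspans t x else false.

Definition tcase (t : tform) : bool :=
  if tbad t.2 then true else if tsingular t then true else
  if tsome (fun p => tstart t (V4 p.1 p.2 T0 T0)) tpairs then true else
  if tsome (fun p => tstart t (V4 T0 T0 p.1 p.2)) tpairs then true else
  ttwo_eckardt t.

(** The normal forms leave 2 * 729 surfaces to examine instead of 729^2. *)
Lemma tsplit_cases : all (fun B => tcase (tsplit, B)) tpencils.
Proof. by vm_compute. Qed.

Lemma tnonsplit_cases : all (fun B => tcase (tnonsplit, B)) tpencils.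
Proof. by vm_compute. Qed.

(** * Soundness of the case analysis *)

(** Provides F_9, where every [tirred s] has a root: X^2 + 1 has no root in F_3. *)
Lemma exists_sqrtN1 : exists (L : fieldExtType 'F_3) (i : L), i ^+ 2 = - 1.
Proof.
have irr : irreducible_poly ('X^2 + 1 : {poly 'F_3}).
  have sz : size ('X^2 + 1 : {poly 'F_3}) = 3%N by rewrite -[1]/(1%:P) size_XnaddC.
  apply: cubic_irreducible; first by rewrite sz.
  move=> x; rewrite /root !hornerE.
  by have [[] ->] := F3_surj x.
have [L _ [i root_i _]] := irredp_FAdjoin irr.
exists L, i; apply/eqP; rewrite -addr_eq0.
by move: root_i; rewrite /root rmorphD /= rmorph1 map_polyXn !hornerE.
Qed.

Lemma teqP x y : teq x y -> x = y.
Proof. by case: x; case: y. Qed.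

Lemma tqeqP p q : tqeq p q -> p = q.
Proof.
case: p q => [[a b] d] [[a' b'] d'] /=.
by do 2!(case: ifP => // /teqP ->); move=> /teqP ->.
Qed.

Lemma tpeqP A B : tpeq A B -> A = B.
Proof.
by case: A B => p q [p' q']; rewrite /tpeq /=; case: ifP => // /tqeqP -> /tqeqP ->.
Qed.

Lemma cubicf_rmorph (R R' : comNzRingType) (f : {rmorphism R -> R'}) (g : trit -> R)
    t a b d e :
  cubicf (f \o g) t (f a) (f b) (f d) (f e) = f (cubicf g t a b d e).
Proof.
case: t => [[[[? ?] ?] [[? ?] ?]] [[[? ?] ?] [[? ?] ?]]].
by rewrite /cubicf /quadf /= !(rmorphD, rmorphM, rmorphXn).
Qed.

Lemma dcubicf_linear (R : comNzRingType) (g : trit -> R) t a b d e a' b' d' e' :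
  dcubicf g t a b d e a' b' d' e' =
  a' * dcubicf g t a b d e 1 0 0 0 + b' * dcubicf g t a b d e 0 1 0 0
  + d' * dcubicf g t a b d e 0 0 1 0 + e' * dcubicf g t a b d e 0 0 0 1.
Proof.
case: t => [[[[? ?] ?] [[? ?] ?]] [[[? ?] ?] [[? ?] ?]]].
by rewrite /dcubicf /quadf /=; ring.
Qed.

Lemma dcubicf_rmorph (R R' : comNzRingType) (f : {rmorphism R -> R'}) (g : trit -> R)
    t a b d e a' b' d' e' :
  dcubicf (f \o g) t (f a) (f b) (f d) (f e) (f a') (f b') (f d') (f e') =
  f (dcubicf g t a b d e a' b' d' e').
Proof.
case: t => [[[[? ?] ?] [[? ?] ?]] [[[? ?] ?] [[? ?] ?]]].
by rewrite /dcubicf /quadf /= !(rmorphD, rmorphM, rmorphXn).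
Qed.

Lemma quadf_rmorph (R R' : comNzRingType) (f : {rmorphism R -> R'})
    (g : trit -> R) q a b :
  quadf (f \o g) q (f a) (f b) = f (quadf g q a b).
Proof. by case: q => [[? ?] ?]; rewrite /quadf /= !(rmorphD, rmorphM, rmorphXn). Qed.

Lemma tquadvE q a b : quadf F3 q (F3 a) (F3 b) = F3 (tquadv q a b).
Proof. by case: q => [[? ?] ?]; rewrite /quadf /tquadv /= !(F3D, F3M); ring. Qed.

Lemma tbad_root A (L : fieldExtType 'F_3) (i : L) : i ^+ 2 = -1 -> tbad A ->
  exists a b : L, [/\ quadf (@emb L \o F3) A.1 a b = 0, quadf (@emb L \o F3) A.2 a b = 0
    & ~ (a = 0 /\ b = 0)].
Proof.
move=> i2; rewrite /tbad; pose f : {rmorphism 'F_3 -> L} := in_alg L.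
rewrite -[@emb L]/(f : 'F_3 -> L); move: f => f.
have f0 x : f (F3 x) = 0 -> tzero x by move=> /eqP; rewrite fmorph_eq0 F3_eq0.
case: ifP => [/tsomeP[[x y] xy_in z01] _|_].
  move: z01 => /=; case: ifP => // z0 z1; exists (f (F3 x)), (f (F3 y)).
  split; try by rewrite quadf_rmorph tquadvE; apply/eqP; rewrite fmorph_eq0 F3_eq0.
  by move=> [/f0 x0 /f0 y0]; case: xy_in x0 y0 => [|[|[|[|//]]]] [<- <-].
case/tsomeP => s _ /tsomeP[[k l] _ /tpeqP ->].
(* At this point (a + s b)^2 + b^2 becomes i^2 + 1 = 0. *)
exists (i - f (F3 s)), 1; split; last by case=> _ /eqP; rewrite oner_eq0.
all: rewrite /quadf /= !(F3D, F3M, rmorphD, rmorphM, rmorph0, rmorph1).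
all: set s' := f (F3 s); set k' := f (F3 _).
all: by transitivity (k' * (i ^+ 2 + 1)); [ring | rewrite i2; ring].
Qed.

Lemma represents_swap c u v w z t :
  represents c u v w z t -> represents c w z u v (t.2, t.1).
Proof.
move=> rep R f a b d e; rewrite -cubicf_swap -(rep R f).
rewrite /evalC; apply: eq_bigr => i _; apply: eq_bigr => j _; apply: eq_bigr => k _.
by congr (_ * _); ring.
Qed.

Lemma indep4_swap u v w z : indep4 u v w z -> indep4 w z u v.
Proof.
move=> ind a b d e E.
have [|-> -> -> ->//] := ind d e a b.
by rewrite -E /rpt -addrA addrC addrA.
Qed.

(** On the first line d = e = 0, and the only derivatives that can be nonzero are the two forms of
    [t.1]; a common root is thus a singular point. *)
Lemma smooth_not_bad c u v w z t :
  smooth c -> indep4 u v w z -> represents c u v w z t -> ~~ tbad t.1.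
Proof.
move=> Sc ind rep; apply/negP => bad.
have [L [i i2]] := exists_sqrtN1.
have [a [b [q0 q1 nz]]] := tbad_root i2 bad.
have [] := smooth_form (a := a) (b := b) (d := 0) (e := 0) Sc ind rep.
- by rewrite /cubicf q0 q1 /quadf; case: (t) => [? [[[? ?] ?] [[? ?] ?]]] /=; ring.
- move=> a' b' d' e'; case: (t) q0 q1.
  move=> [[[? ?] ?] [[? ?] ?]] [[[? ?] ?] [[? ?] ?]] /= q0 q1.
  by rewrite /dcubicf /= q0 q1 /quadf; ring.
by move=> a0 b0 _ _; apply: nz.
Qed.

Lemma smooth_not_singular c u v w z t :
  smooth c -> indep4 u v w z -> represents c u v w z t -> ~~ tsingular t.
Proof.
move=> Sc ind rep; apply/negP => /tsomeP[[a b d e] x_pt].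
case: ifP => // ev0 gr0.
(* The singular point is rational, so any extension of F_3 serves here. *)
have [L _] := exists_sqrtN1; pose f : {rmorphism 'F_3 -> L} := in_alg L.
have := smooth_form (a := f (F3 a)) (b := f (F3 b)) (d := f (F3 d))
  (e := f (F3 e)) Sc ind rep.
rewrite -[@emb L]/(f : 'F_3 -> L); move: f => f [].
- by rewrite cubicf_rmorph tevalE; apply/eqP; rewrite fmorph_eq0 F3_eq0.
- move=> a' b' d' e'; rewrite dcubicf_linear.
  rewrite -[1](rmorph1 f) -[0 in LHS](rmorph0 f) !dcubicf_rmorph.
  rewrite -[1]/(F3 T1) -[0 in LHS]/(F3 T0) !tgradE.
  case: tgrad gr0 => g0 g1 g2 g3 /and4P[].
  by case: g0 g1 g2 g3 => [] [] [] [] // _ _ _ _; rewrite /= !rmorph0 !mulr0 !addr0.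
have f0 x : f (F3 x) = 0 -> tzero x by move=> /eqP; rewrite fmorph_eq0 F3_eq0.
move=> /f0 a0 /f0 b0 /f0 d0 /f0 e0.
have: List.Forall (fun r => ~~ tvzero r) tpoints by repeat constructor.
move=> /List.Forall_forall /(_ _ x_pt); by rewrite /= a0 b0 d0 e0.
Qed.

(** * Changes of basis on the two lines *)

Definition tmatl (g : tvec) (u v : 'rV['F_3]_4) :=
  let: V4 x y _ _ := g in F3 x *: u + F3 y *: v.
Definition tmatr (g : tvec) (u v : 'rV['F_3]_4) :=
  let: V4 _ _ x y := g in F3 x *: u + F3 y *: v.

Lemma quadf_tqsub (R : comNzRingType) (f : {rmorphism 'F_3 -> R}) q x y x' y' a b :
  quadf (f \o F3) (tqsub q (V4 x y x' y')) a b =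
  quadf (f \o F3) q (a * f (F3 x) + b * f (F3 x')) (a * f (F3 y) + b * f (F3 y')).
Proof.
case: q => [[? ?] ?]; rewrite /quadf /tqsub /tquadv /=.
by rewrite !(F3D, F3M, rmorphD, rmorphM); ring.
Qed.

Lemma quadf_tqlin (R : comNzRingType) (f : {rmorphism 'F_3 -> R}) k p l q a b :
  quadf (f \o F3) (tqlin k p l q) a b =
  f (F3 k) * quadf (f \o F3) p a b + f (F3 l) * quadf (f \o F3) q a b.
Proof.
case: p q => [[? ?] ?] [[? ?] ?]; rewrite /quadf /tqlin /=.
by rewrite !(F3D, F3M, rmorphD, rmorphM); ring.
Qed.

(** In [t.2] the lines exchange roles: [h] substitutes variables and [g] recombines the two
    forms. *)
Lemma tpsub_represents c u v w z t g h :
  represents c u v w z t ->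
  represents c (tmatl g u v) (tmatr g u v) (tmatl h w z) (tmatr h w z)
    (tpsub t.1 g h, tpsub t.2 h g).
Proof.
move=> rep R f a b d e; case: g h => g0 g1 g2 g3 [h0 h1 h2 h3].
transitivity (cubicf (f \o F3) t (a * f (F3 g0) + b * f (F3 g2))
  (a * f (F3 g1) + b * f (F3 g3)) (d * f (F3 h0) + e * f (F3 h2))
  (d * f (F3 h1) + e * f (F3 h3))).
  rewrite -(rep R f) /evalC.
  have E i : a * f (tmatl (V4 g0 g1 g2 g3) u v 0 i)
      + b * f (tmatr (V4 g0 g1 g2 g3) u v 0 i)
      + d * f (tmatl (V4 h0 h1 h2 h3) w z 0 i)
      + e * f (tmatr (V4 h0 h1 h2 h3) w z 0 i) =
    (a * f (F3 g0) + b * f (F3 g2)) * f (u 0 i)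
    + (a * f (F3 g1) + b * f (F3 g3)) * f (v 0 i)
    + (d * f (F3 h0) + e * f (F3 h2)) * f (w 0 i)
    + (d * f (F3 h1) + e * f (F3 h3)) * f (z 0 i).
    by rewrite /= !mxE !rmorphD !rmorphM; ring.
  by do 3!(apply: eq_bigr => ? _); rewrite !E.
have := quadf_tqsub f; have := quadf_tqlin f; rewrite /cubicf /tpsub /= => Elin Esub.
rewrite !Elin !Esub; ring.
Qed.

(** Cramer's rule. *)
Lemma tdet_inj g a b : ~~ tzero (tdet g) ->
  let: V4 x y x' y' := g in
  a * F3 x + b * F3 x' = 0 -> a * F3 y + b * F3 y' = 0 -> a = 0 /\ b = 0.
Proof.
case: g => x y x' y' det0 E1 E2.
rewrite -F3_eq0 /tdet F3D F3N !F3M in det0.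
split; apply: (mulIf det0); rewrite mul0r.
  transitivity ((a * F3 x + b * F3 x') * F3 y' - (a * F3 y + b * F3 y') * F3 x').
    by ring.
  by rewrite E1 E2 !mul0r subrr.
transitivity ((a * F3 y + b * F3 y') * F3 x - (a * F3 x + b * F3 x') * F3 y).
  by ring.
by rewrite E1 E2 !mul0r subrr.
Qed.

Lemma tmat_indep4 u v w z g h :
  indep4 u v w z -> ~~ tzero (tdet g) -> ~~ tzero (tdet h) ->
  indep4 (tmatl g u v) (tmatr g u v) (tmatl h w z) (tmatr h w z).
Proof.
move=> ind dg dh a b d e.
have := tdet_inj a b dg; have := tdet_inj d e dh.
case: g h {dg dh} => g0 g1 g2 g3 [h0 h1 h2 h3] Ih Ig E.
have [|E0 E1 E2 E3] := ind (a * F3 g0 + b * F3 g2) (a * F3 g1 + b * F3 g3)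
  (d * F3 h0 + e * F3 h2) (d * F3 h1 + e * F3 h3).
  by rewrite -E; apply/rowP => i; rewrite !mxE; ring.
by have [-> ->] := Ig E0 E1; have [-> ->] := Ih E2 E3.
Qed.

Lemma tmatl_on_line g u v : on_line u v (tmatl g u v).
Proof. by case: g => x y ? ?; exists (F3 x), (F3 y). Qed.

Lemma tmatr_on_line g u v : on_line u v (tmatr g u v).
Proof. by case: g => ? ? x y; exists (F3 x), (F3 y). Qed.

Lemma on_line_trans (u v u' v' P : 'rV['F_3]_4) :
  on_line u v u' -> on_line u v v' -> on_line u' v' P -> on_line u v P.
Proof.
move=> [a [b ->]] [a' [b' ->]] [x [y ->]]; exists (x * a + y * a'), (x * b + y * b').
by apply/rowP => i; rewrite !mxE; ring.
Qed.

(** The extension is F_3 over itself, [('F_3)^o], for which [emb] is the identity. *)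
Lemma eckardtK_rational c P X1 X2 X3 :
  on_SK c P ->
  line_in_S idF3 c P X1 -> line_in_S idF3 c P X2 -> line_in_S idF3 c P X3 ->
  ~ on_line P X1 X2 -> ~ on_line P X1 X3 -> ~ on_line P X2 X3 -> eckardtK c P.
Proof.
move=> SP l1 l2 l3 n12 n13 n23; split=> //.
have embE a : @emb ('F_3)^o a = a by rewrite /emb /GRing.scale /= mulr1.
have lineE X : line_in_S idF3 c P X -> line_in_S (L := ('F_3)^o) (@emb ('F_3)^o) c P X.
  case=> ind lp; split=> //; rewrite -[RHS]lp /line_poly /evalC.
  by do 3!(apply: eq_bigr => ? _); rewrite embE.
have Pon X : on_line (L := ('F_3)^o) P X (map_mx (@emb ('F_3)^o) P).
  exists 1, 0; apply/rowP => i; rewrite mxE embE !mxE.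
  by rewrite mul0r mul1r addr0.
have dist X Y : ~ on_line P X Y -> distinct_lines (L := ('F_3)^o) P X P Y.
  by move=> n [_ [a [b E]]]; apply: n; exists a, b.
exists ('F_3)^o, P, X1, P, X2, P, X3; split; first by split; apply: lineE.
by split; split; auto.
Qed.

Lemma tsome_all_pairs (f : trit * trit -> bool) : ~~ tsome f tpairs ->
  forall x y, f (x, y) = false.
Proof.
move=> nf x y; apply: contraNF nf => fxy.
by case: x y fxy => [] [] /=; do ![case: ifP => //].
Qed.

Lemma tline_sound c u v w z t x y :
  represents c u v w z t -> indep4 u v w z -> tzero (teval t x) -> tline t x y ->
  line_in_S idF3 c (vpt u v w z x) (vpt u v w z y).
Proof.
move=> rep ind x0 /and4P[xy0 yx0 y0 /tsome_all_pairs ind_xy].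
have F30 k : tzero k -> F3 k = 0 by rewrite -F3_eq0 => /eqP.
split; last by rewrite (line_poly_vpt _ _ rep) !F30 // !mul0r !add0r.
move=> a b; have [a' ->] := F3_surj a; have [b' ->] := F3_surj b.
rewrite -vpt_comb => /eqP; rewrite vpt_eq0 //.
by move: (ind_xy a' b'); rewrite /=; case: a' b' => [] [] //= ->.
Qed.

Lemma vpt_inj u v w z x y : indep4 u v w z -> vpt u v w z x = vpt u v w z y -> x = y.
Proof.
move=> ind xy; have : tvzero (tvcomb T1 x T2 y).
  by rewrite -(vpt_eq0 _ ind) vpt_comb xy /= scale1r scaleN1r subrr.
by move: x y {xy} => [a b d e] [a' b' d' e'] /= /and4P[];
  case: a a' => [] [] // _; case: b b' => [] [] // _; case: d d' => [] [] // _;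
  case: e e' => [] [].
Qed.

Lemma tout_sound u v w z x y x' : indep4 u v w z -> tout x y x' ->
  ~ on_line (vpt u v w z x) (vpt u v w z y) (vpt u v w z x').
Proof.
move=> ind /tsome_all_pairs out [a [b]].
have [a' ->] := F3_surj a; have [b' ->] := F3_surj b.
rewrite -vpt_comb => /(vpt_inj ind) E; move: (out a' b'); rewrite E.
have teqxx k : teq k k by case: k.
by case: tvcomb => ? ? ? ?; rewrite /= !teqxx.
Qed.

Lemma teckardt_sound c u v w z t x y1 y2 y3 :
  represents c u v w z t -> indep4 u v w z -> ~~ tvzero x ->
  teckardt t x y1 y2 y3 -> eckardtK c (vpt u v w z x).
Proof.
move=> rep ind nz /and3P[x0 /and3P[l1 l2 l3] /and3P[o12 o13 o23]].
apply: (eckardtK_rational (X1 := vpt u v w z y1) (X2 := vpt u v w z y2)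
  (X3 := vpt u v w z y3)); try exact: tline_sound; try exact: tout_sound.
by apply/(on_SK_vpt _ rep ind); rewrite x0.
Qed.

Lemma vpt_te0 u v w z : vpt u v w z te0 = u.
Proof. by rewrite /vpt /rpt /= scale1r !scale0r !addr0. Qed.

Lemma vpt_te1 u v w z : vpt u v w z te1 = v.
Proof. by rewrite /vpt /rpt /= scale1r !scale0r !addr0 add0r. Qed.

Lemma tcase_sound c u v w z t :
  smooth c -> indep4 u v w z -> represents c u v w z t ->
  ~ (eckardtK c u /\ eckardtK c v) -> tcase t ->
  exists P, [/\ P != 0, on_line u v P \/ on_line w z P &
    forall R, in_span c P R <-> on_SK c R].
Proof.
move=> Sc ind rep nE.
have start x : tstart t x -> [/\ vpt u v w z x != 0, True &
    forall R, in_span c (vpt u v w z x) R <-> on_SK c R].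
  rewrite /tstart; case: ifP => // x0; case: ifP => // nz sp; split=> //.
    by rewrite vpt_eq0 // nz.
  apply: (tspans_sound rep ind _ erefl sp).
  by apply/(on_SK_vpt _ rep ind); rewrite x0 nz.
(* Smoothness along the second line, obtained by exchanging the lines. *)
have badB := smooth_not_bad Sc (indep4_swap ind) (represents_swap rep).
have sing := smooth_not_singular Sc ind rep.
rewrite /tcase (negbTE badB) (negbTE sing).
case: ifP => [/tsomeP[[a b] _ /start[P0 _ spP]] _|_].
  exists (vpt u v w z (V4 a b T0 T0)); split=> //; left.
  by exists (F3 a), (F3 b); rewrite /vpt /rpt /= !scale0r !addr0.
case: ifP => [/tsomeP[[a b] _ /start[P0 _ spP]] _|_].
  exists (vpt u v w z (V4 T0 T0 a b)); split=> //; right.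
  by exists (F3 a), (F3 b); rewrite /vpt /rpt /= !scale0r !add0r.
rewrite /ttwo_eckardt; case: (t.2) => [[[k0 ?] ?] [[? ?] m1]] /andP[E0 E1].
case: nE; split.
  by rewrite -(vpt_te0 u v w z); apply: teckardt_sound E0.
by rewrite -(vpt_te1 u v w z); apply: teckardt_sound E1.
Qed.

(** * Completeness of the enumeration and conclusion *)

Lemma In_allpairs (A B C : Type) (f : A -> B -> C) s s' x y :
  List.In x s -> List.In y s' -> List.In (f x y) [seq f a b | a <- s, b <- s'].
Proof.
elim: s => //= a s IH [->|xs] ys; apply/List.in_or_app; last by right; apply: IH.
by left; elim: s' ys {IH} => //= b s' IH' [->|ys]; [left | right; apply: IH'].
Qed.

Lemma In_tpencils A : List.In A tpencils.
Proof.
have In_trits x : List.In x trits by case: x => /=; tauto.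
have In_tquads q : List.In q tquads.
  case: q => [[a b] d].
  apply: (In_allpairs (fun p s => (p.1, p.2, s)) (x := (a, b))) => //.
  exact: In_allpairs.
by case: A => p q; apply: In_allpairs.
Qed.

Lemma all_In (A : Type) (f : pred A) s x : all f s -> List.In x s -> f x.
Proof. by elim: s => //= y s IH /andP[fy fs] [<-|/IH]; auto. Qed.

Lemma treducibleP A : treducible A -> exists g h,
  [/\ ~~ tzero (tdet g), ~~ tzero (tdet h)
    & tpsub A g h = tsplit \/ tpsub A g h = tnonsplit].
Proof.
move=> /tsomeP[g g_in /tsomeP[h h_in /= red]]; exists g, h; split.
- have: List.Forall (fun g => ~~ tzero (tdet g)) tcosets by repeat constructor.
  by move=> /List.Forall_forall; apply.
- by have [] := (In_filter_seq _ _ _).1 h_in.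
by move: red; case: ifP => [/tpeqP|_ /tpeqP]; auto.
Qed.

Theorem theorem2 (c : cubic) (u v u' v' : 'rV['F_3]_4) :
  smooth c ->
  line_in_S idF3 c u v -> line_in_S idF3 c u' v' -> skew_lines u v u' v' ->
  (forall P Q, on_line u v P -> on_line u v Q -> eckardtK c P -> eckardtK c Q ->
     exists a : 'F_3, Q = a *: P) ->
  (forall P Q, on_line u' v' P -> on_line u' v' Q -> eckardtK c P -> eckardtK c Q ->
     exists a : 'F_3, Q = a *: P) ->
  exists P : 'rV['F_3]_4,
    [/\ P != 0, on_line u v P \/ on_line u' v' P &
        forall R, in_span c P R <-> on_SK c R].
Proof.
move=> Sc luv luv' skew Euv _.
have [t rep] := exists_form luv luv'.
have [ind_uv _] := luv; have [ind_uv' _] := luv'.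
(* A relation among the four vectors gives a common vector of the two lines, which skewness makes
   zero. *)
have ind : indep4 u v u' v'.
  move=> a b d e; rewrite /rpt -addrA => E0.
  have E : a *: u + b *: v = (- d) *: u' + (- e) *: v'.
    by apply/eqP; rewrite -subr_eq0 !scaleNr opprD !opprK E0.
  have uv0 := skew _ _ _ _ E; have [-> ->] := ind_uv _ _ uv0.
  by move: E0; rewrite uv0 add0r => /ind_uv'[-> ->].
have := all_In tpencils_reduce (In_tpencils t.1).
rewrite /= (negbTE (smooth_not_bad Sc ind rep)) => /treducibleP[g [h [dg dh red]]].
have ind' := tmat_indep4 ind dg dh.
have rep' := tpsub_represents g h rep.
have cases_t : tcase (tpsub t.1 g h, tpsub t.2 h g).
  case: red => ->.
    exact: (all_In tsplit_cases (In_tpencils _)).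
  exact: (all_In tnonsplit_cases (In_tpencils _)).
have [|P [P0 onP spP]] := tcase_sound Sc ind' rep' _ cases_t.
  (* Two Eckardt points on the first line would be proportional, but they are its new basis
     vectors. *)
  case=> E1 E2.
  have [a Ea] := Euv _ _ (tmatl_on_line g u v) (tmatr_on_line g u v) E1 E2.
  have [|_ /eqP] := ind' a (-1) 0 0.
    by rewrite /rpt !scale0r !addr0 Ea scaleN1r subrr.
  by rewrite oppr_eq0 oner_eq0.
exists P; split=> //; case: onP => onP; [left | right];
  by apply: on_line_trans onP; [exact: tmatl_on_line | exact: tmatr_on_line].
Qed.
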